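(* Fix a difference equation $\pmb\omega=(1/f,q,w)$. Let $$\mathbf{A}(a_{11},b_{22}):=\left [\begin{array} {cccc}a_{11}&-1&0&\bar{z}\\ z&0&-1&b_{22}\end{array} \right ]\in \mathcal{O}_{2,3}^{\mathbb{C}},$$ where $z\neq0$, and let $$\mathbf{S}_5:=\left [\begin{array} {cccc}1&0&0&0\\ 0&0&-1&b_{22}\end{array} \right ],\qquad \mathbf{S}_6:=\left [\begin{array} {cccc}a_{11}&-1&0&0\\ 0&0&0&1\end{array} \right ].$$ Then $(\pmb\omega,\mathbf{A}(a_{11},b_{22}))$ has exactly $N$ eigenvalues if $ b_{22}(a_{11}+f_0)\neq|z|^2$, and exactly $N-1$ eigenvalues if $ b_{22}(a_{11}+f_0)=|z|^2$; $(\pmb\omega,\mathbf{S}_5)$ has exactly $N$ eigenvalues if $ b_{22}\neq0$, and exactly $N-1$ eigenvalues if $ b_{22}=0$; $(\pmb\omega,\mathbf{S}_6)$ has exactly $N$ eigenvalues if $ a_{11}+f_0\neq0$, and exactly $N-1$ eigenvalues if $ a_{11}+f_0=0$. Further: (i) if $b_{22}=0$, then for any $a_{11}^{(1)}< a_{11}^{(2)}$, the eigenvalues $\lambda_n(a_{11}^{(i)})$ of $(\pmb\omega, \mathbf{A}(a_{11}^{(i)},b_{22}))$, $i=1,2$, and $\lambda_n(\mathbf{S}_5)$ of $(\pmb\omega,\mathbf{S}_5)$ satisfy $$( * )\quad \lambda_0(a_{11}^{(1)})\leq\lambda_0(a_{11}^{(2)})\leq\lambda_0(\mathbf{S}_5)\leq\lambda_1(a_{11}^{(1)})\leq\lambda_1(a_{11}^{(2)})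 \leq\lambda_1(\mathbf{S}_5)\leq\cdots\leq \lambda_{N-2}(a_{11}^{(1)})\leq\lambda_{N-2}(a_{11}^{(2)})\leq\lambda_{N-2}(\mathbf{S}_5)\leq\lambda_{N-1}(a_{11}^{(1)})\leq\lambda_{N-1}(a_{11}^{(2)});$$ (ii) if $b_{22}\neq0$, then for any $a_{11}^{(1)}<a_{11}^{(2)}\leq|z|^2/b_{22}-f_0<a_{11}^{(3)}<a_{11}^{(4)}$, the eigenvalues $\lambda_n(a_{11}^{(i)})$ of $(\pmb\omega, \mathbf{A}(a_{11}^{(i)},b_{22}))$, $i=1,\dots,4$, and $\lambda_n(\mathbf{S}_5)$ satisfy $$( ** )\quad \lambda_0(a_{11}^{(3)})\leq \lambda_0(a_{11}^{(4)})\leq\lambda_0(\mathbf{S}_5)\leq\lambda_0(a_{11}^{(1)})\leq\lambda_0(a_{11}^{(2)})\leq \lambda_1(a_{11}^{(3)})\leq\lambda_1(a_{11}^{(4)}) \leq\lambda_1(\mathbf{S}_5)\leq\lambda_1(a_{11}^{(1)})\leq \lambda_1(a_{11}^{(2)}) \leq\cdots\leq\lambda_{N-2}(a_{11}^{(3)})\leq \lambda_{N-2}(a_{11}^{(4)})\leq\lambda_{N-2}(\mathbf{S}_5)\leq\lambda_{N-2}(a_{11}^{(1)})\leq\lambda_{N-2}(a_{11}^{(2)})\leq \lambda_{N-1}(a_{11}^{(3)})\leq\lambda_{N-1}(a_{11}^{(4)})\leq\lambda_{N-1}(\mathbf{S}_5)\leq\lambda_{N-1}(a_{11}^{(1)}),$$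 and in addition $\lambda_{N-1}(a_{11}^{(1)})\leq\lambda_{N-1}(a_{11}^{(2)})$ if $a_{11}^{(2)}<|z|^2/b_{22}-f_0$; (iii) if $a_{11}+f_0=0$, then for any $b_{22}^{(1)}< b_{22}^{(2)}$, the eigenvalues $\lambda_n(b_{22}^{(i)})$ of $(\pmb\omega, \mathbf{A}(a_{11},b_{22}^{(i)}))$ and $\lambda_n(\mathbf{S}_6)$ of $(\pmb\omega,\mathbf{S}_6)$ satisfy $( * )$ with $a_{11}^{(i)}$ and $\mathbf{S}_5$ replaced by $b_{22}^{(i)}$ and $\mathbf{S}_6$, $i=1,2$; (iv) if $a_{11}+f_0\neq0$, then for any $b_{22}^{(1)}<b_{22}^{(2)}\leq|z|^2/(a_{11}+f_0)<b_{22}^{(3)}<b_{22}^{(4)}$, the eigenvalues $\lambda_n(b_{22}^{(i)})$ of $(\pmb\omega, \mathbf{A}(a_{11},b_{22}^{(i)}))$ and $\lambda_n(\mathbf{S}_6)$ satisfy $( ** )$ with $a_{11}^{(i)}$ and $\mathbf{S}_5$ replaced by $b_{22}^{(i)}$ and $\mathbf{S}_6$, $i=1,\dots,4$, and in addition $\lambda_{N-1}(b_{22}^{(1)})\leq\lambda_{N-1}(b_{22}^{(2)})$ if $b_{22}^{(2)}<|z|^2/(a_{11}+f_0)$.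
   Context: Discrete Sturm–Liouville problem: equation $-\nabla(f_n\Delta y_n)+q_ny_n=\lambda w_ny_n$, $n\in[1,N]$, $N\ge2$, with real $f_n\neq0$ ($0\le n\le N$), real $q_n$, $w_n>0$ ($1\le n\le N$), abbreviated $\pmb\omega=(1/f,q,w)$; boundary condition $A(y_0, f_0\Delta y_0)^T+B(y_N,f_N\Delta y_N)^T=0$ with $\operatorname{rank}(A,B)=2$, denoted $[A\,|\,B]$ (an equivalence class modulo left multiplication by invertible $2\times2$ matrices), self-adjoint: $AJA^*=BJB^*$, $J=\begin{pmatrix}0&1\\-1&0\end{pmatrix}$. $\mathcal{O}_{2,3}^{\mathbb{C}}$ is the set of BCs $\left[\begin{smallmatrix}a_{11}&-1&0&\bar z\\ z&0&-1&b_{22}\end{smallmatrix}\right]$ with $a_{11},b_{22}\in\mathbb{R}$, $z\in\mathbb{C}$. All eigenvalues are real, counted with multiplicity and listed non-decreasingly $\lambda_0\le\lambda_1\le\cdots$. *)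

(* Defs.v *)
From HB Require Import structures.
From mathcomp Require Import all_boot all_order all_algebra.
From mathcomp Require Import complex.
Set Implicit Arguments. Unset Strict Implicit. Unset Printing Implicit Defensive.
Import Order.TTheory GRing.Theory Num.Theory.
Local Open Scope ring_scope.

Section DSL.
Variable R : rcfType.
Local Notation C := (complex R).

Definition rC (x : R) : C := Complex x 0.

Definition mx24 (a11 a12 a13 a14 a21 a22 a23 a24 : C) : 'M[C]_(2,4) :=
  \matrix_(i < 2, j < 4)
    nth 0 (if i == 0 :> nat then [:: a11; a12; a13; a14]
           else [:: a21; a22; a23; a24]) j.

(* The linear system of the problem
     -nabla(f_n Delta y_n) + q_n y_n = lambda w_n y_n,  1 <= n <= N,
     A (y_0, f_0 Delta y_0)^T + B (y_N, f_N Delta y_N)^T = 0,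
   in the unknowns y_0, ..., y_(N+1) (column j <-> y_j), written as a matrix
   M(lambda) with entries in {poly C} (the variable 'X is lambda).
   Rows 0..N-1: equation n = i+1, expanded as
     -f_n y_(n+1) + (f_n + f_(n-1) + q_n - lambda w_n) y_n - f_(n-1) y_(n-1).
   Rows N, N+1: rows k = 0, 1 of the boundary condition [A|B] = BC. *)
Definition dsl_mx (N : nat) (f q w : nat -> R) (BC : 'M[C]_(2,4))
  : 'M[{poly C}]_(N.+2) :=
  \matrix_(i < N.+2, j < N.+2)
    if (i < N)%N then
      let n := i.+1 in
      (rC ((if j == n.+1 :> nat then - f n else 0)
         + (if j == n :> nat then f n + f n.-1 + q n else 0)
         + (if j == n.-1 :> nat then - f n.-1 else 0)))%:P
      - (rC (if j == n :> nat then w n else 0))%:P * 'X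
    else
      let k : 'I_2 := inord (i - N) in
      let b (c : nat) : C := BC k (inord c) in
      ((if j == 0%N :> nat then b 0%N - b 1%N * rC (f 0%N) else 0)
     + (if j == 1%N :> nat then b 1%N * rC (f 0%N) else 0)
     + (if j == N :> nat then b 2%N - b 3%N * rC (f N) else 0)
     + (if j == N.+1 :> nat then b 3%N * rC (f N) else 0))%:P.

(* characteristic function: lambda is an eigenvalue iff it is a root, and the
   multiplicity of an eigenvalue is its multiplicity as a root. *)
Definition dsl_char (N : nat) (f q w : nat -> R) (BC : 'M[C]_(2,4))
  : {poly C} := \det (dsl_mx N f q w BC).

(* s is the list of all eigenvalues of the problem (omega, BC), counted with
   multiplicity and listed non-decreasingly (all eigenvalues being real):
   every complex x occurs in s (as a real) exactly mu_x(char) times. *)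
Definition dsl_eigenlist (N : nat) (f q w : nat -> R) (BC : 'M[C]_(2,4))
  (s : seq R) : Prop :=
  dsl_char N f q w BC != 0 /\ sorted <=%R s /\
  forall x : C, count (fun r => rC r == x) s = mup x (dsl_char N f q w BC).

Definition bcA (z : C) (a11 b22 : R) : 'M[C]_(2,4) :=
  mx24 (rC a11) (-1) 0 (conjc z) z 0 (-1) (rC b22).
Definition bcS5 (b22 : R) : 'M[C]_(2,4) :=
  mx24 1 0 0 0 0 0 (-1) (rC b22).
Definition bcS6 (a11 : R) : 'M[C]_(2,4) :=
  mx24 (rC a11) (-1) 0 0 0 0 0 1.

(* interlacing pattern ( * ): s1 = lambda(param^(1)), s2 = lambda(param^(2)),
   s = lambda(S), sizes N, N, N-1 *)
Definition chain1 (N : nat) (s1 s2 s : seq R) : Prop :=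
  (forall n, (n < N)%N -> nth 0 s1 n <= nth 0 s2 n) /\
  (forall n, (n < N.-1)%N ->
     nth 0 s2 n <= nth 0 s n /\ nth 0 s n <= nth 0 s1 n.+1).

(* interlacing pattern ( ** ): s1..s4 = lambda(param^(1..4)), s = lambda(S) *)
Definition chain2 (N : nat) (s1 s2 s3 s4 s : seq R) : Prop :=
  (forall n, (n < N)%N ->
     nth 0 s3 n <= nth 0 s4 n /\ nth 0 s4 n <= nth 0 s n /\
     nth 0 s n <= nth 0 s1 n) /\
  (forall n, (n < N.-1)%N ->
     nth 0 s1 n <= nth 0 s2 n /\ nth 0 s2 n <= nth 0 s3 n.+1).

End DSL.

(* Main.v *)
Require Import Defs.
From HB Require Import structures.
From mathcomp Require Import all_boot all_order all_algebra.
From mathcomp Require Import complex.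
From mathcomp Require Import perm sesquilinear spectral.
From mathcomp Require Import ring zify.
Set Implicit Arguments. Unset Strict Implicit. Unset Printing Implicit Defensive.
Import Order.TTheory GRing.Theory Num.Theory.
Local Open Scope ring_scope.
Local Open Scope complex_scope.
Local Open Scope sesquilinear_scope.

(* Take y_0, u = f_N Delta y_N and sqrt(w_k) y_k as unknowns and put
   c = a11 + f_0. The characteristic function is then, up to a nonzero constant,
     det [[c, z^*, -e^*], [z, b22, -g^*], [-e, -g, T - lambda]]
   with T Hermitian and e, g multiples of the first and last basis vectors;
   S5 and S6 delete the row and column of y_0, respectively of u. Eliminating
   the border turns every problem of a given chain into det (A + k l l^* - lambda)
   with A and l fixed and k in R, or, for k = oo, into the compression of A to
   the hyperplane l^perp, which loses one eigenvalue. For c != 0 this is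
   k = -1 / (b22 - |z|^2 / c) and S6 is k = 0; for c = 0 it is k = b22 / |z|^2
   and S6 is k = oo; exchanging (c, e) and (b22, g) gives the case of S5. All the
   inequalities follow from the spectral theorem and the Courant-Fischer
   dimension count, which yield monotonicity in k and Cauchy interlacing with
   the compression. *)

(** * Hermitian spectra and the Courant-Fischer count *)

Section Spectral.
Variable R : rcfType.
Local Notation C := (complex R).

Lemma adjmxM m n p (A : 'M[C]_(m, n)) (B : 'M_(n, p)) :
  (A *m B)^t* = B^t* *m A^t*.
Proof. by rewrite trmx_mul map_mxM. Qed.

(** The rows of [U] are orthonormal, but only the compression of [A] to their span has to be
    diagonal. A rectangular [U] thus covers part of an eigenbasis as well as an eigenbasis of a
    compression. *)
Definition diag_sys n m (A : 'M[C]_n) (U : 'M[C]_(m, n)) (d : 'I_m -> R) :=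
  U *m U^t* = 1%:M /\ U *m A *m U^t* = diag_mx (\row_i (d i)%:C).

Lemma diag_sys_rayleigh n m (A : 'M[C]_n) U (d : 'I_m -> R) (a : 'rV_m) :
  diag_sys A U d ->
  (((a *m U) *m (a *m U)^t*) 0 0 = \sum_i `|a 0 i| ^+ 2) /\
  (((a *m U) *m A *m (a *m U)^t*) 0 0 = \sum_i (d i)%:C * `|a 0 i| ^+ 2).
Proof.
move=> [UU UAU]; rewrite adjmxM; split.
  rewrite mulmxA -(mulmxA a) UU mulmx1 mxE; apply: eq_bigr => i _.
  by rewrite !mxE normCK.
rewrite mulmxA -(mulmxA a) -(mulmxA a) UAU mxE; apply: eq_bigr => i _.
rewrite !mxE (bigD1 i) //= big1 ?addr0 => [|j /negPf ji].
  by rewrite !mxE eqxx mulr1n normCK mulrA [a 0 i * _]mulrC.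
by rewrite !mxE ji mulr0n mulr0.
Qed.

Lemma diag_sys_rowsub n m k (A : 'M[C]_n) U (d : 'I_m -> R) (f : 'I_k -> 'I_m) :
  injective f -> diag_sys A U d -> diag_sys A (rowsub f U) (d \o f).
Proof.
move=> inj_f [UU UAU].
have sub (X : 'M[C]_n) :
    rowsub f U *m X *m (rowsub f U)^t* = mxsub f f (U *m X *m U^t*).
  by rewrite mul_rowsub_mx trmx_mxsub map_mxsub -mxsub_mul.
split.
  move: (sub 1%:M); rewrite !mulmx1 UU => ->.
  by apply/matrixP=> i j; rewrite !mxE (inj_eq inj_f).
rewrite sub UAU; apply/matrixP=> i j; rewrite !mxE (inj_eq inj_f).
by case: eqP => [->|].
Qed.

(* Courant-Fischer in the form of a dimension count. *)
Lemma diag_sys_le n m k (A B : 'M[C]_n) (U : 'M_(m, n)) (V : 'M_(k, n)) d s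
    (x y : R) :
  diag_sys A U d -> diag_sys B V s -> (n < m + k)%N ->
  (forall i, x <= d i) -> (forall j, s j <= y) ->
  (forall v : 'rV_n, (v <= U)%MS -> (v <= V)%MS ->
     (v *m A *m v^t*) 0 0 <= (v *m B *m v^t*) 0 0) ->
  x <= y.
Proof.
move=> HU HV lt_n le_d le_s le_AB.
have rU : \rank U = m by rewrite mxrank_unitary //; apply/unitarymxP; case: HU.
have rV : \rank V = k by rewrite mxrank_unitary //; apply/unitarymxP; case: HV.
(* Row spaces of ranks m and k with m + k > n share a nonzero vector. *)
have : (U :&: V)%MS != 0.
  rewrite -mxrank_eq0 -lt0n -(ltn_add2l (\rank (U + V)%MS)) addn0.
  by rewrite mxrank_sum_cap rU rV (leq_ltn_trans (rank_leq_col _)).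
case/rowV0Pn=> v; rewrite sub_capmx => /andP[vU vV] v0.
have {le_AB} := le_AB v vU vV.
have v_gt0 : 0 < (v *m v^t*) 0 0.
  have : 0 <= (v *m v^t*) 0 0.
    by rewrite mxE sumr_ge0 // => i _; rewrite !mxE mul_conjC_ge0.
  rewrite le_eqVlt => /orP[/eqP e0|//]; case/eqP: v0.
  apply/rowP=> i; rewrite mxE; apply/eqP.
  have := esym e0; rewrite mxE => /psumr_eq0P H.
  have ge0 j : true -> 0 <= v 0 j * (v^t*) j 0.
    by rewrite !mxE mul_conjC_ge0.
  by have := H ge0 i isT; rewrite !mxE => /eqP; rewrite mul_conjC_eq0.
have [a av] := submxP vU; have [b bv] := submxP vV.
have [n1 q1] := diag_sys_rayleigh a HU; have [n2 q2] := diag_sys_rayleigh b HV.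
rewrite -av in n1 q1; rewrite -bv in n2 q2.
rewrite q1 q2 => le12.
(* On the span of [U] the form of [A] is at least x |v|^2, on that of [V] the form of [B] is at most
   y |v|^2. *)
have : x%:C * (v *m v^t*) 0 0 <= y%:C * (v *m v^t*) 0 0.
  apply: (le_trans _ (le_trans le12 _)).
    rewrite n1 mulr_sumr ler_sum // => i _.
    by rewrite ler_wpM2r ?exprn_ge0 // lecR.
  rewrite n2 mulr_sumr ler_sum // => i _.
  by rewrite ler_wpM2r ?exprn_ge0 // lecR.
by rewrite ler_pM2r // lecR.
Qed.

(* The increasing list of the eigenvalues of the compression of [A] to an
   [m]-dimensional subspace orthogonal to [l]. *)
Definition speclist n (m : nat) (A : 'M[C]_n) (l : 'cV[C]_n) (d : seq R) :=
  [/\ size d = m, sorted <=%R d &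
      exists2 U : 'M[C]_(m, n), diag_sys A U (fun i => nth 0 d i) & U *m l = 0].

(** The eigenvectors of [A] with index at least i span m - i dimensions, those of [B] with index at
    most j span j + 1, so the dimension count applies. The vectors of the first span kill [l], those
    of the second kill [l'], hence the forms are compared only where both vanish. *)
Lemma speclist_le n m k (A B : 'M[C]_n) (l l' : 'cV_n) d s i j :
  speclist m A l d -> speclist k B l' s ->
  (i < m)%N -> (j < k)%N -> (n < m - i + j.+1)%N ->
  (forall v : 'rV_n, v *m l = 0 -> v *m l' = 0 ->
     (v *m A *m v^t*) 0 0 <= (v *m B *m v^t*) 0 0) ->
  nth 0 d i <= nth 0 s j.
Proof.
move=> [sd od [U HU Ul]] [ss os [V HV Vl]] im jk lt_n le_AB.
have lt1 (a : 'I_(m - i)) : (a + i < m)%N by rewrite addnC -ltn_subRL ltn_ord.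
pose f1 a := Ordinal (lt1 a); pose f2 := @widen_ord j.+1 k jk.
have inj1 : injective f1.
  by move=> a b /(congr1 val) /= /addIn /val_inj.
have inj2 : injective f2 by move=> a b /(congr1 val) /= /val_inj.
apply: (diag_sys_le (diag_sys_rowsub inj1 HU) (diag_sys_rowsub inj2 HV) lt_n).
- move=> a /=; apply: sorted_leq_nth => //; rewrite ?inE ?sd //.
  + exact: le_trans.
  + exact: leq_addl.
- move=> a /=; apply: sorted_leq_nth => //; rewrite ?inE ?ss //.
  + exact: le_trans.
  + by rewrite (leq_trans (ltn_ord a)).
- by rewrite -ltnS.
move=> v vU vV; apply: le_AB.
  have /submxP[a ->] : (v <= U)%MS by apply: submx_trans vU _; exact: rowsub_sub.
  by rewrite -mulmxA Ul mulmx0.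
have /submxP[a ->] : (v <= V)%MS by apply: submx_trans vV _; exact: rowsub_sub.
by rewrite -mulmxA Vl mulmx0.
Qed.

(** Spectral theorem, with the rows of the unitary matrix permuted so that the eigenvalues come out
    sorted. *)
Lemma speclist_full n (A : 'M[C]_n) : A^t* = A ->
  exists2 d, speclist n A 0 d &
    forall x, \det (A - x%:M) = \prod_(r <- d) (r%:C - x).
Proof.
move=> hA.
have herm : A \is hermsymmx by apply/is_hermitianmxP; rewrite expr0 scale1r hA.
have realD := hermitian_spectral_diag_real herm.
have /orthomx_spectralP := hermitian_normalmx herm.
have := spectral_unitarymx A.
set U := spectralmx A; set D := spectral_diag A => uU eA.
pose r i := complex.Re (D 0 i).
have DE i : D 0 i = (r i)%:C.
  by rewrite /r RRe_real //; have /mxOverP := realD; apply.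
have UU : U *m U^t* = 1%:M by apply/unitarymxP.
have iU : invmx U = U^t* by apply: invmx_unitary.
pose t := [tuple r i | i < n].
have st : size (sort <=%R t) == n by rewrite size_sort size_tuple.
have /tuple_permP [p ep] : perm_eq (Tuple st) t by rewrite perm_sort.
have dE (i : 'I_n) : nth 0 (sort <=%R t) i = r (p i).
  rewrite (ep : sort <=%R t = _).
  by rewrite -[LHS](tnth_nth 0 [tuple tnth t (p i) | i < n]) !tnth_mktuple.
have UAU : U *m A *m U^t* = diag_mx D.
  rewrite [X in U *m X]eA iU !mulmxA UU mul1mx.
  by rewrite -mulmxA UU mulmx1.
exists (sort <=%R t); last first.
  move=> x; transitivity (\det (diag_mx D - x%:M)).
    have detU : \det U * \det (U^t*) = 1 by rewrite -det_mulmx UU det1.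
    rewrite -[LHS]mulr1 -detU mulrC mulrAC -!det_mulmx mulmxBr mulmxBl UAU.
    by rewrite mul_mx_scalar -scalemxAl UU scalemx1.
  have -> : diag_mx D - x%:M = diag_mx (\row_i (D 0 i - x)).
    by apply/matrixP=> i j; rewrite !mxE mulrnBl.
  rewrite det_diag (perm_big t) ?perm_sort //= big_map big_enum /=.
  by apply: eq_bigr => i _; rewrite mxE DE.
split.
- exact/eqP.
- by apply: sort_sorted => a b; exact: le_total.
exists (rowsub p U); last by rewrite mulmx0.
have : diag_sys A U r.
  by split=> //; rewrite UAU; congr diag_mx; apply/rowP=> i; rewrite mxE DE.
move/(diag_sys_rowsub (@perm_inj _ p)) => [? eU]; split=> //.
by rewrite eU; congr diag_mx; apply/rowP=> i; rewrite !mxE dE.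
Qed.

(** * Bordered determinants and Schur complements *)

Definition border n (c : C) (r : 'rV[C]_n) (q : 'cV_n) (X : 'M_n) : 'M[C]_(1 + n) :=
  block_mx c%:M r q X.

Lemma det_border n (c : C) r q (X : 'M[C]_n) : c != 0 ->
  \det (border c r q X) = c * \det (X - c^-1 *: (q *m r)).
Proof.
move=> c0.
have -> : border c r q X = block_mx 1%:M 0 (c^-1 *: q) 1%:M *m
                           block_mx c%:M r 0 (X - c^-1 *: (q *m r)).
  rewrite mulmx_block !mul1mx !mul0mx !addr0 -!scalemxAl.
  rewrite mul_mx_scalar scalerA mulVf // scale1r.
  by rewrite [_ *: _ + _]addrC subrK.
by rewrite det_mulmx det_lblock det_ublock !det1 !mul1r det_scalar1.
Qed.

Definition border2 n (k11 k12 : C) (r1 : 'rV[C]_n) (k21 k22 : C) (r2 : 'rV_n)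
    (q1 q2 : 'cV_n) (X : 'M_n) : 'M[C]_(1 + (1 + n)) :=
  border k11 (row_mx k12%:M r1) (col_mx k21%:M q1) (border k22 r2 q2 X).

(** Eliminating the first border leaves a single one, whose corner, row, column and core are
    replaced by their Schur complements. *)
Lemma det_border2 n (k11 k12 : C) r1 (k21 k22 : C) r2 q1 q2 (X : 'M[C]_n) : k11 != 0 ->
  \det (border2 k11 k12 r1 k21 k22 r2 q1 q2 X) =
  k11 * \det (border (k22 - k11^-1 * (k21 * k12)) (r2 - (k11^-1 * k21) *: r1)
                     (q2 - (k11^-1 * k12) *: q1) (X - k11^-1 *: (q1 *m r1))).
Proof.
move=> k0; rewrite [LHS]det_border //; congr (_ * \det _).
rewrite mul_col_row scale_block_mx opp_block_mx add_block_mx.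
rewrite -scalar_mxM mul_scalar_mx mul_mx_scalar !scalerA.
by rewrite scale_scalar_mx -raddfN -raddfD.
Qed.

(** Used to pivot on an off-diagonal corner entry when the diagonal one is zero. *)
Lemma det_border2_swapcol n k11 k12 r1 k21 k22 r2 q1 q2 (X : 'M[C]_n) :
  \det (border2 k11 k12 r1 k21 k22 r2 q1 q2 X) =
  - \det (border2 k12 k11 r1 k22 k21 r2 q2 q1 X).
Proof.
pose j0 : 'I_(1 + (1 + n)) := lshift _ 0.
pose j1 : 'I_(1 + (1 + n)) := rshift 1 (lshift n 0).
have j01 : j0 != j1 by [].
have blockE := (block_mxEul, block_mxEur, block_mxEdl, block_mxEdr,
                col_mxEu, col_mxEd, row_mxEl, row_mxEr).
have -> : border2 k11 k12 r1 k21 k22 r2 q1 q2 X =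
          xcol j0 j1 (border2 k12 k11 r1 k22 k21 r2 q2 q1 X).
  apply/matrixP=> i j; rewrite [RHS]mxE /border2 /border.
  case: (split_ordP j) => [j' ->|j' ->]; last case: (split_ordP j') => [{}j' ->|{}j' ->].
  - rewrite (ord1 j') tpermL /j1.
    case: (split_ordP i) => [i' ->|i' ->]; last case: (split_ordP i') => [{}i' ->|{}i' ->];
      by rewrite !blockE.
  - rewrite (ord1 j') tpermR /j0.
    case: (split_ordP i) => [i' ->|i' ->]; last case: (split_ordP i') => [{}i' ->|{}i' ->];
      by rewrite !blockE.
  - rewrite tpermD //.
    case: (split_ordP i) => [i' ->|i' ->]; last case: (split_ordP i') => [{}i' ->|{}i' ->];
      by rewrite !blockE.
by rewrite xcolE det_mulmx det_perm odd_tperm j01 expr1 mulrN1.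
Qed.

(** The row exchange is a column exchange of the transpose, and the two signs cancel. This is the
    symmetry between the two ends of the interval. *)
Lemma det_border2_swap n k11 k12 r1 k21 k22 r2 q1 q2 (X : 'M[C]_n) :
  \det (border2 k11 k12 r1 k21 k22 r2 q1 q2 X) =
  \det (border2 k22 k21 r2 k12 k11 r1 q2 q1 X).
Proof.
have tr a11 a12 s1 a21 a22 s2 p1 p2 (Y : 'M[C]_n) :
    (border2 a11 a12 s1 a21 a22 s2 p1 p2 Y)^T =
    border2 a11 a21 p1^T a12 a22 p2^T s1^T s2^T Y^T.
  rewrite /border2 /border !tr_block_mx tr_row_mx tr_col_mx.
  by rewrite !tr_scalar_mx.
rewrite [LHS]det_border2_swapcol -[in LHS]det_tr tr [in LHS]det_border2_swapcol opprK.
by rewrite -[LHS]det_tr tr !trmxK.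
Qed.

(** In a basis made of l and an orthonormal basis of its orthogonal complement, the border row and
    the border column keep one nonzero entry each; expanding along them leaves the characteristic
    determinant of the compression. *)
Lemma speclist_hyp n (A : 'M[C]_n.+1) (l : 'cV_n.+1) : A^t* = A -> l != 0 ->
  exists2 d, speclist n A l d &
    exists2 k : C, k != 0 & forall x,
    \det (border 0 (- l^t*) (- l) (A - x%:M)) = k * \prod_(r <- d) (r%:C - x).
Proof.
move=> hA l0.
have rl : \rank l = 1%N.
  apply/eqP; rewrite eqn_leq rank_leq_col lt0n mxrank_eq0 //.
have : exists2 K : 'M[C]_(\rank (kermx l), n.+1), row_free K & K *m l = 0.
  exists (row_base (kermx l)); first exact: row_base_free.
  by apply/sub_kermxP; rewrite eq_row_base.
rewrite mxrank_ker rl subn1 /= => -[K freeK Kl].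
pose U := schmidt K.
have UU : U *m U^t* = 1%:M by apply/unitarymxP/schmidt_unitarymx.
have Ul : U *m l = 0.
  apply/sub_kermxP; rewrite eqmx_schmidt_free //; exact/sub_kermxP.
have lU : l^t* *m U^t* = 0 by rewrite -adjmxM Ul; apply/matrixP=> i j; rewrite !mxE conjC0.
have [d [sd od [V [VV VUV] _]] detV] : exists2 d, speclist n (U *m A *m U^t*) 0 d &
    forall x, \det (U *m A *m U^t* - x%:M) = \prod_(r <- d) (r%:C - x).
  apply: speclist_full; rewrite !adjmxM trmxCK hA mulmxA //.
exists d.
  split=> //; exists (V *m U); last by rewrite -mulmxA Ul mulmx0.
  split; rewrite adjmxM !mulmxA.
    by rewrite -(mulmxA V) UU mulmx1 VV.
  by rewrite -VUV !mulmxA.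
pose s : C := (l^t* *m l) 0 0.
have s0 : s != 0.
  apply: contraNneq l0; rewrite /s mxE => /psumr_eq0P H; apply/eqP/colP=> i.
  have ge0 j : true -> 0 <= (l^t*) 0 j * l j 0.
    by rewrite !mxE mulrC mul_conjC_ge0.
  by have := H ge0 i isT; rewrite !mxE mulrC => /eqP; rewrite mul_conjC_eq0 => /eqP.
have sE : l^t* *m l = s%:M by apply/matrixP=> i j; rewrite !ord1 [RHS]mxE.
(* The first row stays unnormalized, of square length s, so the congruence by [Q] multiplies
   determinants by s. *)
pose P : 'M[C]_(1 + n) := col_mx (l^t*) U.
have PP : P *m P^t* = block_mx s%:M 0 0 1%:M.
  rewrite /P tr_col_mx map_row_mx mul_col_row trmxCK sE lU UU.
  by rewrite Ul.
have Pl : P *m l = col_mx s%:M 0 by rewrite mul_col_mx Ul sE.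
have detP : \det P * \det (P^t*) = s.
  by rewrite -det_mulmx PP det_ublock det_scalar1 det1 mulr1.
pose Q : 'M[C]_(1 + (1 + n)) := block_mx 1%:M 0 0 P.
have QE X : Q *m border 0 (- l^t*) (- l) X *m Q^t* =
    border 0 (- (P *m l)^t*) (- (P *m l)) (P *m X *m P^t*).
  rewrite /Q /border tr_block_mx map_block_mx !mulmx_block.
  rewrite !trmx0 !map_mx0 trmx1 map_mx1.
  rewrite ?(mul0mx, mulmx0, mul1mx, mulmx1, addr0, add0r).
  by rewrite mulmxN mulNmx adjmxM.
have detQ : \det Q * \det (Q^t*) = s.
  rewrite tr_block_mx map_block_mx !trmx0 !map_mx0 trmx1 map_mx1.
  by rewrite !det_ublock !det1 !mul1r.
exists (- s^*); first by rewrite oppr_eq0 conjC_eq0.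
move=> x; rewrite -detV.
(* The border entries -s^* and -s give, with the sign of the column swap, -s s^* in total; the
   factor s is that of the congruence. *)
apply: (mulfI s0); rewrite -{1}detQ mulrAC -!det_mulmx QE.
set Y := U *m A *m U^t* - x%:M.
pose a : C := (l^t* *m A *m l) 0 0 - x * s.
have -> : border 0 (- (P *m l)^t*) (- (P *m l)) (P *m (A - x%:M) *m P^t*) =
  border2 0 (- s^*) 0 (- s) a (l^t* *m A *m U^t*) 0 (U *m A *m l) Y.
  have -> : P *m (A - x%:M) *m P^t* = border a (l^t* *m A *m U^t*) (U *m A *m l) Y.
    rewrite mulmxBr mulmxBl mul_mx_scalar -scalemxAl PP.
    rewrite /P tr_col_mx map_row_mx mul_col_mx mul_col_row trmxCK.
    rewrite scale_block_mx opp_block_mx add_block_mx !scaler0 !subr0 scalemx1.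
    congr block_mx; rewrite scale_scalar_mx.
    by rewrite [l^t* *m A *m l]mx11_scalar -raddfB.
  rewrite /border2 Pl opp_col_mx tr_col_mx map_row_mx opp_row_mx.
  rewrite trmx0 map_mx0 !oppr0 tr_scalar_mx map_scalar_mx -!raddfN.
  by [].
rewrite det_border2_swapcol det_border2; last by rewrite oppr_eq0 conjC_eq0.
rewrite !mulr0 !scaler0 !scale0r !subr0 mulmx0 scaler0 subr0.
rewrite det_ublock det_scalar1; by rewrite !mulNr !mulrN !opprK mulrCA.
Qed.

End Spectral.

(** * Rank-one perturbations and interlacing *)

Section Rank1.
Variable R : rcfType.
Local Notation C := (complex R).

Lemma conjC_rC (a : R) : (a%:C)^*%R = a%:C.
Proof. by rewrite -[LHS]/(conjc _) conjc_real. Qed.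

Lemma rC_neq0 (a : R) : a != 0 -> a%:C != 0.
Proof. by move=> a0; apply: contra_neq a0 => -[]. Qed.

Lemma adjmxD m n (A B : 'M[C]_(m, n)) : (A + B)^t* = A^t* + B^t*.
Proof. by rewrite linearD map_mxD. Qed.

Lemma adjmxN m n (A : 'M[C]_(m, n)) : (- A)^t* = - A^t*.
Proof. by rewrite linearN map_mxN. Qed.

Lemma adjmxZ m n (a : C) (A : 'M[C]_(m, n)) : (a *: A)^t* = a^*%R *: A^t*.
Proof. by rewrite linearZ map_mxZ. Qed.

Definition rank1_pert n (A : 'M[C]_n) (l : 'cV_n) (k : R) : 'M[C]_n :=
  A + k%:C *: (l *m l^t*).

Lemma rank1_pert_herm n (A : 'M[C]_n) l k :
  A^t* = A -> (rank1_pert A l k)^t* = rank1_pert A l k.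
Proof.
by move=> hA; rewrite /rank1_pert adjmxD adjmxZ adjmxM trmxCK hA conjC_rC.
Qed.

Lemma rank1_pert_form n (A : 'M[C]_n) l k (v : 'rV_n) :
  (v *m rank1_pert A l k *m v^t*) 0 0 =
  (v *m A *m v^t*) 0 0 + k%:C * `|(v *m l) 0 0| ^+ 2.
Proof.
rewrite /rank1_pert mulmxDr mulmxDl mxE; congr (_ + _).
rewrite -scalemxAr -scalemxAl mxE; congr (_ * _).
rewrite mulmxA -(mulmxA (v *m l)) -adjmxM [v *m l]mx11_scalar tr_scalar_mx map_scalar_mx.
by rewrite -scalar_mxM !mxE eqxx mulr1n normCK.
Qed.

(** From k to k' the form grows by (k' - k) |v l|^2 at v. *)
Lemma speclist_rank1_le n (A : 'M[C]_n) l k k' d s i : k <= k' ->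
  speclist n (rank1_pert A l k) 0 d -> speclist n (rank1_pert A l k') 0 s ->
  (i < n)%N -> nth 0 d i <= nth 0 s i.
Proof.
move=> le_k Hd Hs lti; apply: (speclist_le Hd Hs lti lti); first by lia.
move=> v _ _; rewrite [leLHS]rank1_pert_form [leRHS]rank1_pert_form.
move: ((v *m A *m v^t*) 0 0) (_ ^+ 2) (exprn_ge0 2 (normr_ge0 ((v *m l) 0 0))) => a y y0.
by rewrite lerD2l ler_wpM2r // lecR.
Qed.

(** The perturbation is invisible on vectors killed by [l], so all k share one compression, and
    Cauchy interlacing with it links lists for different k across an index shift. *)
Lemma speclist_hyp_interlace n (A : 'M[C]_n.+1) l k d s i :
  speclist n.+1 (rank1_pert A l k) 0 d -> speclist n A l s -> (i < n)%N ->
  nth 0 d i <= nth 0 s i /\ nth 0 s i <= nth 0 d i.+1.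
Proof.
move=> Hd Hs lti.
have eqf (v : 'rV_n.+1) : v *m l = 0 ->
    (v *m rank1_pert A l k *m v^t*) 0 0 = (v *m A *m v^t*) 0 0.
  move=> vl; have vl0 : (v *m l) 0 0 = 0 by rewrite vl mxE.
  by rewrite rank1_pert_form vl0 normr0 expr0n mulr0 addr0.
split.
  apply: (speclist_le Hd Hs (ltnW lti) lti); first by lia.
  by move=> v _ vl; rewrite eqf.
apply: (speclist_le (j := i.+1) Hs Hd lti lti); first by lia.
by move=> v vl _; rewrite eqf.
Qed.

Lemma speclist_eqform n m (A B : 'M[C]_n) l d :
  (forall U : 'M_(m, n), U *m l = 0 -> U *m A *m U^t* = U *m B *m U^t*) ->
  speclist m A l d -> speclist m B l d.
Proof.
move=> eqAB [sd od [U [UU UAU] Ul]]; split=> //; exists U => //; split=> //.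
by rewrite -eqAB.
Qed.

(** Stated for functions so that determinants enter pointwise in x; the constant absorbs pivots and
    changes of basis. *)
Definition is_spec (p : C -> C) (d : seq R) :=
  sorted <=%R d /\
  exists2 k : C, k != 0 & forall x, p x = k * \prod_(r <- d) (r%:C - x).

Lemma is_spec_scale (p p' : C -> C) (k : C) d :
  k != 0 -> (forall x, p x = k * p' x) -> is_spec p' d -> is_spec p d.
Proof.
move=> k0 pE [od [k' k'0 p'E]]; split=> //; exists (k * k').
  by rewrite mulf_neq0.
by move=> x; rewrite pE p'E mulrA.
Qed.

Lemma is_spec_full n (A : 'M[C]_n) : A^t* = A ->
  exists2 d, speclist n A 0 d & is_spec (fun x => \det (A - x%:M)) d.
Proof.
move=> /speclist_full[d Hd dE]; exists d => //; split; first by case: Hd.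
by exists 1; [exact: oner_neq0 | move=> x; rewrite mul1r dE].
Qed.

Lemma is_spec_hyp n (A : 'M[C]_n.+1) (l : 'cV_n.+1) : A^t* = A -> l != 0 ->
  exists2 d, speclist n A l d &
    is_spec (fun x => \det (border 0 (- l^t*) (- l) (A - x%:M))) d.
Proof.
move=> hA l0; have [d Hd dE] := speclist_hyp hA l0.
by exists d => //; split; first by case: Hd.
Qed.

Definition sqabs (z : C) : R := complex.Re z ^+ 2 + complex.Im z ^+ 2.

Lemma sqabsE z : (sqabs z)%:C = z * z^*%R.
Proof. by rewrite /sqabs add_Re2_Im2 normCK. Qed.

(** * Spectra of the doubly bordered families *)

Section Family.
Variables (n : nat) (T : 'M[C]_n.+1) (e g : 'cV[C]_n.+1) (z : C).
Hypothesis hT : T^t* = T.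
Hypothesis z0 : z != 0.
Hypothesis e0 : e != 0.
Hypothesis indep : forall a : C, g != a *: e.

(** With [e], [g] the left and right end vectors, [c] = a11 + f_0 and [b] = b22, this is the
    characteristic function of [bcA] up to a constant. The chains below move [b] with [c] fixed;
    [charS] drops the border that carries [b]. *)
Definition charA (c b : R) (x : C) :=
  \det (border2 c%:C z^*%R (- e^t*) z b%:C (- g^t*) (- e) (- g) (T - x%:M)).
Definition charS (c : R) (x : C) := \det (border c%:C (- e^t*) (- e) (T - x%:M)).

Lemma is_spec_charS c : c != 0 ->
  exists2 d, speclist n.+1 (T - c^-1%:C *: (e *m e^t*)) 0 d & is_spec (charS c) d.
Proof.
move=> c0.
have hA : (T - c^-1%:C *: (e *m e^t*))^t* = T - c^-1%:C *: (e *m e^t*).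
  by rewrite adjmxD adjmxN adjmxZ adjmxM trmxCK hT conjC_rC.
have [d Hd Sd] := is_spec_full hA; exists d => //.
apply: (is_spec_scale (rC_neq0 c0)) Sd => x.
rewrite /charS [LHS]det_border; last exact: rC_neq0.
apply: (congr1 (fun Z => c%:C * \det Z)).
rewrite mulmxN mulNmx opprK -fmorphV /=.
by move: (e *m _) => Z; rewrite [RHS]addrAC.
Qed.

Lemma charS_size c : exists2 d, is_spec (charS c) d &
  size d = if c == 0 then n else n.+1.
Proof.
have [->|c0] := eqVneq c 0.
  by have [d [sd _ _] Sd] := is_spec_hyp hT e0; exists d.
by have [d [sd _ _] Sd] := is_spec_charS c0; exists d.
Qed.

Let nz2 := sqabs z.

Let nz2_neq0 : nz2 != 0.
Proof.
apply/eqP => H; have := sqabsE z; rewrite -/nz2 H => /esym/eqP.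
by rewrite mul_conjC_eq0 (negPf z0).
Qed.

Let nz2_gt0 : 0 < nz2.
Proof. by rewrite lt_def nz2_neq0 addr_ge0 ?sqr_ge0. Qed.

(** * Families with a nonzero corner [c] *)

Section NonzeroCorner.
Variable c : R.
Hypothesis c0 : c != 0.

(** Pivoting on [c] turns [T] into [A] and the border [g] into [l], which is nonzero since [g] is no
    multiple of [e]. *)
Let A : 'M[C]_n.+1 := T - c^-1%:C *: (e *m e^t*).
Let l : 'cV[C]_n.+1 := g - (c^-1%:C * z^*%R) *: e.

Let hA : A^t* = A.
Proof. by rewrite /A adjmxD adjmxN adjmxZ adjmxM trmxCK hT conjC_rC. Qed.

Let l0 : l != 0.
Proof. by rewrite subr_eq0. Qed.

(** The remaining corner is the signed distance of [b] to the threshold |z|^2 / c. If nonzero it is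
    a second pivot and yields a rank-one term; if zero the determinant is that of a compression. *)
Let charAE b x :
  charA c b x = c%:C * \det (border (b - nz2 / c)%:C (- l^t*) (- l) (A - x%:M)).
Proof.
rewrite /charA [LHS]det_border2; last exact: rC_neq0.
rewrite -fmorphV /=.
congr (_ * \det (border _ _ _ _)).
- by rewrite -sqabsE rmorphB rmorphM /= mulrC.
- rewrite /l adjmxD adjmxN adjmxZ rmorphM /= conjCK conjC_rC scalerN opprK.
  by rewrite opprD opprK.
- by rewrite scalerN opprK opprD opprK.
- by rewrite mulmxN mulNmx opprK addrAC.
Qed.

Let spec_charA_neq b : b - nz2 / c != 0 ->
  exists2 d, speclist n.+1 (rank1_pert A l (- (b - nz2 / c)^-1)) 0 d &
             is_spec (charA c b) d.
Proof.
move=> d0; have [d Hd Sd] := is_spec_full (rank1_pert_herm l (- (b - nz2 / c)^-1) hA).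
exists d => //; apply: is_spec_scale Sd; last first.
  move=> x; rewrite charAE det_border ?rC_neq0 // mulrA; congr (_ * \det _).
  rewrite /rank1_pert mulmxN mulNmx opprK -fmorphV rmorphN scaleNr /=.
  by move: A (l *m _) => A' Z; rewrite [RHS]addrAC.
by rewrite mulf_neq0 ?rC_neq0.
Qed.

Let spec_charA_eq b : b - nz2 / c = 0 ->
  exists2 d, speclist n A l d & is_spec (charA c b) d.
Proof.
move=> d0; have [d Hd Sd] := is_spec_hyp hA l0.
exists d => //; apply: is_spec_scale Sd; last first.
  by move=> x; rewrite charAE d0; reflexivity.
exact: rC_neq0.
Qed.

Let spec_charS : exists2 d, speclist n.+1 (rank1_pert A l 0) 0 d & is_spec (charS c) d.
Proof.
have [d Hd Sd] := is_spec_charS c0; exists d => //.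
by rewrite /rank1_pert scale0r addr0.
Qed.

Lemma charA_size_neq0 b : exists2 d, is_spec (charA c b) d &
  size d = if b * c == nz2 then n else n.+1.
Proof.
have -> : (b * c == nz2) = (b - nz2 / c == 0).
  by rewrite subr_eq0 -[RHS](inj_eq (mulIf c0)) divfK.
case: eqP => [/spec_charA_eq|/eqP /spec_charA_neq] [d [sd _ _] Sd];
  by exists d.
Qed.

(** With k = -1 / (b - |z|^2 / c), b3 < b4 above the threshold give k3 < k4 < 0, [charS] is k = 0,
    and b1 < b2 below it give 0 < k1 < k2, with k2 = oo at the threshold. Monotonicity in k orders
    the lists at equal index; the compression leads from b2 to the next index of b3. *)
Lemma charA_chain2 b1 b2 b3 b4 :
  b1 < b2 -> b2 <= nz2 / c -> nz2 / c < b3 -> b3 < b4 ->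
  exists s1 s2 s3 s4 s : seq R,
  [/\ is_spec (charA c b1) s1, is_spec (charA c b2) s2, is_spec (charA c b3) s3 &
      is_spec (charA c b4) s4] /\ is_spec (charS c) s /\
  (chain2 n.+1 s1 s2 s3 s4 s /\
   (b2 < nz2 / c -> nth 0 s1 n <= nth 0 s2 n)).
Proof.
move=> lt12 le2 lt3 lt34.
have [s Hs Ss] := spec_charS.
have lt1 : b1 - nz2 / c < 0 by rewrite subr_lt0; apply: lt_le_trans le2.
have gt3 : 0 < b3 - nz2 / c by rewrite subr_gt0.
have gt4 : 0 < b4 - nz2 / c by rewrite subr_gt0; apply: lt_trans lt34.
have [s1 Hs1 Ss1] := spec_charA_neq (ltr0_neq0 lt1).
have [s3 Hs3 Ss3] := spec_charA_neq (lt0r_neq0 gt3).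
have [s4 Hs4 Ss4] := spec_charA_neq (lt0r_neq0 gt4).
(* [t] is the spectrum of the compression, an upper bound for the list of b2 both below and at the
   threshold. *)
have : exists t s2, [/\ speclist n A l t, is_spec (charA c b2) s2,
    (forall i, (i < n)%N -> nth 0 s1 i <= nth 0 s2 i /\ nth 0 s2 i <= nth 0 t i) &
        (b2 < nz2 / c -> nth 0 s1 n <= nth 0 s2 n)].
  move: le2; rewrite le_eqVlt => /orP[/eqP e2|lt2].
    have [|s2 Hs2 Ss2] := @spec_charA_eq b2; first by rewrite e2 subrr.
    (* At the threshold the list of b2 is [t] itself and has only n entries, so entry n would be the
       default 0; the strict inequality excludes this case. *)
    exists s2, s2; split=> //; last by rewrite e2 ltxx.
    by move=> i lti; case: (speclist_hyp_interlace Hs1 Hs2 lti).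
  have lt2' : b2 - nz2 / c < 0 by rewrite subr_lt0.
  have [s2 Hs2 Ss2] := spec_charA_neq (ltr0_neq0 lt2').
  have le_k : - (b1 - nz2 / c)^-1 <= - (b2 - nz2 / c)^-1.
    by rewrite lerN2 lef_nV2 ?negrE //; rewrite lerD2r ltW.
  have [t Ht _] := is_spec_hyp hA l0.
  exists t, s2; split=> // [i lti|_].
    split; first exact: (speclist_rank1_le le_k Hs1 Hs2 (leqW lti)).
    by case: (speclist_hyp_interlace Hs2 Ht lti).
  exact: (speclist_rank1_le le_k Hs1 Hs2).
case=> t [s2 [Ht Ss2 le_s2 last_s2]].
exists s1, s2, s3, s4, s; split=> //; split=> //; split=> //; split=> i lti.
  split; last split.
  - apply: (speclist_rank1_le _ Hs3 Hs4 lti).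
    by rewrite lerN2 lef_pV2 ?posrE // lerD2r ltW.
  - by apply: (speclist_rank1_le _ Hs4 Hs lti); rewrite oppr_le0 invr_ge0 ltW.
  - by apply: (speclist_rank1_le _ Hs Hs1 lti); rewrite oppr_ge0 invr_le0 ltW.
have [le1 le2'] := le_s2 i lti; split=> //; apply: le_trans le2' _.
by case: (speclist_hyp_interlace Hs3 Ht lti).
Qed.

End NonzeroCorner.

(** * Families with a zero corner *)

Let A0 : 'M[C]_n.+1 := T - ((z^*%R)^-1 *: (g *m e^t*) + z^-1 *: (e *m g^t*)).

Let hA0 : A0^t* = A0.
Proof.
have zV : ((z^*%R)^-1)^*%R = z^-1 by rewrite fmorphV /= conjCK.
have zV' : (z^-1)^*%R = (z^*%R)^-1 by rewrite fmorphV.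
rewrite /A0 adjmxD adjmxN adjmxD !adjmxZ !adjmxM !trmxCK hT zV zV'.
by move: (g *m _) (e *m g^t*) => X Y; rewrite [X in _ - X]addrC.
Qed.

(** The corner [[0, z^*], [z, b]] is eliminated by swapping columns and pivoting on z^* and then z.
    The parameter survives only in the term b / |z|^2 times e e^*, so [A0] is common to all b. *)
Let spec_charA0 b : exists2 d, speclist n.+1 (rank1_pert A0 e (b / nz2)) 0 d &
  is_spec (charA 0 b) d.
Proof.
have [d Hd Sd] := is_spec_full (rank1_pert_herm e (b / nz2) hA0).
have zc0 : z^*%R != 0 by rewrite conjC_eq0.
exists d => //; apply: is_spec_scale Sd; last first.
  move=> x; rewrite /charA det_border2_swapcol det_border2 // !mulr0 scale0r.
  rewrite !subr0 det_border // mulrA -mulNr; congr (_ * \det _).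
  rewrite /rank1_pert /A0 rmorphM fmorphV /= sqabsE invfM.
  rewrite scalerN opprK mulmxDr !mulNmx !mulmxN !opprK -scalemxAr.
  move: (g *m _) (e *m g^t*) (e *m e^t*) => X1 X2 X3.
  by apply/matrixP=> i j; rewrite !mxE; ring.
by rewrite oppr_eq0 mulf_neq0.
Qed.

(** Each term of T - A0 has a factor e or its adjoint, so both matrices have the same compression to
    the complement of [e]. *)
Let spec_charS0 : exists2 d, speclist n A0 e d & is_spec (charS 0) d.
Proof.
have [d Hd Sd] := is_spec_hyp hT e0.
exists d => //; apply: speclist_eqform Hd => U Ue.
have eU : e^t* *m U^t* = 0 by rewrite -adjmxM Ue trmx0 map_mx0.
rewrite /A0 mulmxBr mulmxBl mulmxDr mulmxDl -!scalemxAr -!scalemxAl.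
by rewrite !mulmxA Ue !mul0mx -!(mulmxA _ _ (U^t*)) eU !mulmx0 !scaler0 addr0 subr0.
Qed.

Lemma charA_size c b : exists2 d, is_spec (charA c b) d &
  size d = if b * c == nz2 then n else n.+1.
Proof.
have [->|c0] := eqVneq c 0; last first.
  exact: (charA_size_neq0 c0 b).
have [d [sd _ _] Sd] := spec_charA0 b.
by exists d; rewrite // mulr0 eq_sym (negPf nz2_neq0).
Qed.

(** Here k = b / |z|^2 increases with b and [charS] is k = oo, so monotonicity and Cauchy
    interlacing give the whole chain. *)
Lemma charA_chain1 b1 b2 : b1 < b2 ->
  exists s1 s2 s : seq R,
  [/\ is_spec (charA 0 b1) s1, is_spec (charA 0 b2) s2 & is_spec (charS 0) s] /\
  chain1 n.+1 s1 s2 s.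
Proof.
move=> lt12.
have [s Hs Ss] := spec_charS0.
have [s1 Hs1 Ss1] := spec_charA0 b1; have [s2 Hs2 Ss2] := spec_charA0 b2.
exists s1, s2, s; split=> //; split=> i lti.
  apply: (speclist_rank1_le _ Hs1 Hs2 lti).
  by rewrite ler_pM2r ?invr_gt0 // ltW.
split; first by case: (speclist_hyp_interlace Hs2 Hs lti).
by case: (speclist_hyp_interlace Hs1 Hs lti).
Qed.

End Family.

End Rank1.

(** * Characteristic polynomials and eigenvalue lists *)

Section Eigenlist.
Variable R : rcfType.
Local Notation C := (complex R).

Lemma poly_horner_inj (F : numDomainType) (p q : {poly F}) : (forall x, p.[x] = q.[x]) -> p = q.
Proof.
move=> pq; apply/eqP; rewrite -subr_eq0; apply/negPn/negP => d0.
(* A nonzero p - q has fewer than [size (p - q)] roots, yet it vanishes at that many integers. *)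
pose rs := [seq i%:R : F | i <- iota 0 (size (p - q))].
have := max_poly_roots (rs := rs) d0; rewrite size_map size_iota ltnn.
move=> H; suff: false by []; apply: H.
  by apply/allP=> x _; rewrite rootE !hornerE pq subrr.
rewrite map_inj_uniq ?iota_uniq // => i j /eqP.
by rewrite eqr_nat => /eqP.
Qed.

(** The product formula determines the polynomial, and multiplicities add up over its linear
    factors. *)
Lemma is_spec_mup (p : {poly C}) d : is_spec (horner p) d ->
  p != 0 /\ forall x, count (fun r => rC r == x) d = mup x p.
Proof.
case=> _ [k k0 pE].
pose q d := \prod_(r <- d) ((r%:C : C)%:P - 'X).
have lin0 (c : C) : c%:P - 'X != 0 :> {poly C}.
  by rewrite -opprB oppr_eq0 polyXsubC_eq0.
have q0 d' : q d' != 0.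
  by rewrite /q prodf_seq_neq0; apply/allP => r _; rewrite lin0 implybT.
have -> : p = k%:P * q d.
  apply: poly_horner_inj => x; rewrite pE hornerM hornerC horner_prod.
  by congr (_ * _); apply: eq_bigr => r _; rewrite !hornerE.
split; first by rewrite mulf_neq0 ?polyC_eq0.
move=> x; rewrite mupMr ?rootC //.
have mupl (c : C) : mup x (c%:P - 'X) = (c == x).
  have -> : c%:P - 'X = (-1)%:P * ('X - c%:P) ^+ 1 :> {poly C}.
    by rewrite polyCN mulN1r opprB.
  rewrite mupMr; last by rewrite rootC oppr_eq0 oner_eq0.
  by rewrite mup_XsubCX; case: eqP.
elim: d {pE} => [|r d IH] /=.
  by rewrite /q big_nil mupNroot // root1.
rewrite IH /q big_cons mupM //; last exact: q0.
by rewrite mupl.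
Qed.

Lemma is_spec_eigenlist N f q w (BC : 'M[C]_(2, 4)) d :
  is_spec (horner (dsl_char N f q w BC)) d -> dsl_eigenlist N f q w BC d.
Proof. by move=> Sd; have [? ?] := is_spec_mup Sd; case: Sd. Qed.

(** Sorted lists with equal counts coincide. A chain proved for one constructed list therefore holds
    for every eigenvalue list. *)
Lemma eigenlist_unique N f q w (BC : 'M[C]_(2, 4)) d s :
  is_spec (horner (dsl_char N f q w BC)) d -> dsl_eigenlist N f q w BC s -> s = d.
Proof.
move=> Sd [_ [os cs]]; have [_ cd] := is_spec_mup Sd.
apply: (sorted_eq le_trans le_anti) => //; first by case: Sd.
apply/allP => x _; apply/eqP.
have H t : count (pred1 x) t = count (fun r => rC r == rC x) t.
  by apply: eq_count => y /=; apply/eqP/eqP => [->|[]].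
by rewrite !H cs cd.
Qed.

End Eigenlist.

(** * Reduction of the difference equation to a bordered Jacobi matrix *)

Section Reduction.
Variable R : rcfType.
Local Notation C := (complex R).
Variables (n : nat) (f q w : nat -> R).
Hypothesis n1 : (0 < n)%N.
Let N := n.+1.
Hypothesis Hf : forall k, (k <= N)%N -> f k != 0.
Hypothesis Hw : forall k, (1 <= k <= N)%N -> 0 < w k.

(** Scaling both y_k and equation k by this factor turns the coefficient w_k of lambda into 1 and
    keeps the matrix symmetric. *)
Definition wscale k : R := (Num.sqrt (w k))^-1.

Lemma wscale_neq0 k : (1 <= k <= N)%N -> wscale k != 0.
Proof. by move=> /Hw w0; rewrite invr_eq0 gt_eqF // sqrtr_gt0. Qed.

Lemma wscale_sqr k : (1 <= k <= N)%N -> wscale k * wscale k * w k = 1.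
Proof.
move=> kN; have w0 := Hw kN; rewrite -[X in _ * X]sqr_sqrtr ?ltW // -invfM -expr2.
by rewrite mulVf // expf_neq0 // gt_eqF // sqrtr_gt0.
Qed.

Lemma sum_delta M k (F : nat -> C) (c : C) : (k < M)%N ->
  \sum_(a < M) F a * (if a == k :> nat then c else 0) = F k * c.
Proof.
move=> kM; rewrite (bigD1 (Ordinal kM)) //= eqxx big1 ?addr0 // => a ak.
by rewrite ifN ?mulr0.
Qed.

(* The new unknowns are y_0, f_N Delta y_N and sqrt(w_k) y_k for 1 <= k <= N,
   in this order; the two boundary rows come first. *)
Definition colidx j := if j == 1%N then N.+1 else j.-1.
Definition colscale j : C :=
  if j == 0%N then 1 else if j == 1%N then (f N)^-1%:C else (wscale j.-1)%:C.
(** With u = f_N Delta y_N one has y_(N+1) = y_N + u / f_N, so the column of sqrt(w_N) y_N feeds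
    y_(N+1) as well. *)
Definition colshift j : C := if j == N.+1 then (wscale N)%:C else 0.
Definition rowidx i := if (i < 2)%N then (N + i)%N else (i - 2)%N.
Definition rowscale i : C := if (i < 2)%N then 1 else (wscale i.-1)%:C.

Definition colmx : 'M[C]_(N.+2) := \matrix_(a, j)
  ((if a == colidx j :> nat then colscale j else 0) +
   (if a == N.+1 :> nat then colshift j else 0)).
Definition rowmx : 'M[C]_(N.+2) := \matrix_(i, a)
  (if a == rowidx i :> nat then rowscale i else 0).

Lemma colidx_lt j : (j < N.+2)%N -> (colidx j < N.+2)%N.
Proof. by rewrite /colidx; case: ifP => //; lia. Qed.

Lemma rowidx_lt i : (i < N.+2)%N -> (rowidx i < N.+2)%N.
Proof. by rewrite /rowidx; case: ifP => //; lia. Qed.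

Lemma mul_colmx m (X : 'M[C]_(m, N.+2)) i (j : 'I_(N.+2)) :
  (X *m colmx) i j = X i (inord (colidx j)) * colscale j + X i ord_max * colshift j.
Proof.
rewrite mxE; under eq_bigr => a _ do rewrite mxE mulrDr -[a in X i a]inord_val.
rewrite big_split /=.
rewrite (sum_delta (fun a => X i (inord a))) ?colidx_lt //.
rewrite (sum_delta (fun a => X i (inord a))) //.
by congr (_ + X i _ * _); apply: val_inj; rewrite /= inordK.
Qed.

Lemma mul_rowmx m (X : 'M[C]_(N.+2, m)) (i : 'I_(N.+2)) j :
  (rowmx *m X) i j = rowscale i * X (inord (rowidx i)) j.
Proof.
rewrite mxE; under eq_bigr => a _ do rewrite mxE mulrC -[a in X a j]inord_val.
by rewrite (sum_delta (fun a => X (inord a) j)) ?rowidx_lt // mulrC.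
Qed.

Lemma rCE (a : R) : rC a = a%:C.
Proof. by []. Qed.

Lemma colscale_neq0 j : (j < N.+2)%N -> colscale j != 0.
Proof.
move=> jN; rewrite /colscale; case: (j =P 0%N) => [_|j0]; first exact: oner_neq0.
case: (j =P 1%N) => j1; apply: rC_neq0; first by rewrite invr_eq0 Hf.
by apply: wscale_neq0; lia.
Qed.

Lemma rowscale_neq0 i : (i < N.+2)%N -> rowscale i != 0.
Proof.
move=> iN; rewrite /rowscale; case: ltnP => [_|i2]; first exact: oner_neq0.
by apply: rC_neq0; apply: wscale_neq0; lia.
Qed.

(** A row vector killed by [colmx] vanishes at index N + 1 because of column 1, which has no shift;
    the shift then drops out and every other column kills one coordinate. *)
Lemma det_colmx : \det colmx != 0.
Proof.
suff: kermx colmx == 0 by rewrite kermx_eq0 row_free_unit unitmxE unitfE.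
have := mulmx_ker colmx; move: (kermx colmx) => X X0.
have XE i (j : 'I_(N.+2)) :
    X i (inord (colidx j)) * colscale j + X i ord_max * colshift j = 0.
  by rewrite -mul_colmx X0 mxE.
have Xmax i : X i ord_max = 0.
  have := XE i (inord 1); rewrite inordK //.
  have -> : colidx 1 = N.+1 by [].
  have -> : colshift 1 = 0 by [].
  rewrite mulr0 addr0 => /eqP.
  rewrite mulf_eq0 (negPf (colscale_neq0 _)) // orbF => /eqP <-.
  by congr (X _ _); apply: val_inj; rewrite /= inordK.
apply/eqP/matrixP=> i a; rewrite [RHS]mxE.
(* [j] inverts [colidx]. *)
pose j := if a == 0 :> nat then 0%N else if a == N.+1 :> nat then 1%N else a.+1.
have ja : (j < N.+2)%N by have := ltn_ord a; rewrite /j; do 2?case: eqP => //=; lia.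
have := XE i (inord j); rewrite Xmax mul0r addr0 inordK // => /eqP.
rewrite mulf_eq0 (negPf (colscale_neq0 _)) // orbF => /eqP <-.
congr (X _ _); apply: val_inj; rewrite /= inordK ?colidx_lt //.
rewrite /j /colidx; case: (val a =P 0%N) => [->//|a0] /=.
by case: (val a =P N.+1) => [->//|a1] /=; rewrite eqSS; case: eqP.
Qed.

Lemma det_rowmx : \det rowmx != 0.
Proof.
suff: cokermx rowmx == 0 by rewrite cokermx_eq0 row_full_unit unitmxE unitfE.
have := mulmx_coker rowmx; move: (cokermx rowmx) => X X0.
apply/eqP/matrixP=> a k; rewrite [RHS]mxE.
(* [i] inverts [rowidx]. *)
pose i := if (a < N)%N then (a + 2)%N else (a - N)%N.
have ia : (i < N.+2)%N by have := ltn_ord a; rewrite /i; case: (ltnP a N); lia.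
have := mul_rowmx X (inord i) k; rewrite X0 mxE inordK // => /esym/eqP.
rewrite mulf_eq0 (negPf (rowscale_neq0 _)) //= => /eqP <-.
congr (X _ _); apply: val_inj; rewrite /= inordK ?rowidx_lt //.
rewrite /i /rowidx; have := ltn_ord a; case: (ltnP a N) => aN lta.
  by rewrite ltnNge leq_addl /= addnK.
by rewrite ltn_subLR // addn2 lta subnKC.
Qed.

Definition stencil k m : R :=
  (if m == k.+1 then - f k else 0)
  + (if m == k then f k + f k.-1 + q k else 0)
  + (if m == k.-1 then - f k.-1 else 0).

(** Evaluated entries of [dsl_mx], indexed by plain naturals so that permuted and shifted indices
    can be computed with directly. *)
Definition dsl_entry (BC : 'M[C]_(2, 4)) (x : C) (i j : nat) : C :=
  if (i < N)%N then
    rC (stencil i.+1 j) - rC (if j == i.+1 then w i.+1 else 0) * x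
  else
    let k : 'I_2 := inord (i - N) in
    let b (c : nat) : C := BC k (inord c) in
    ((if j == 0%N then b 0%N - b 1%N * rC (f 0%N) else 0)
   + (if j == 1%N then b 1%N * rC (f 0%N) else 0)
   + (if j == N then b 2%N - b 3%N * rC (f N) else 0)
   + (if j == N.+1 then b 3%N * rC (f N) else 0)).

Lemma dsl_char_horner BC x :
  (dsl_char N f q w BC).[x] = \det (\matrix_(i < N.+2, j < N.+2) dsl_entry BC x i j).
Proof.
rewrite /dsl_char -horner_evalE -det_map_mx; congr (\det _).
apply/matrixP=> i j; rewrite !mxE /= /horner_eval /dsl_entry.
by case: ifP => _; rewrite !hornerE.
Qed.

(** Substituting y_(N+1) = y_N + u / f_N in equation N adds -f_N to the coefficient of y_N. *)
Definition jacobi_entry k m : R :=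
  stencil k m - (if (m == N) && (k == N) then f N else 0).

Definition jacobi : 'M[C]_N :=
  \matrix_(i, j) (wscale i.+1 * wscale j.+1 * jacobi_entry i.+1 j.+1)%:C.
(** Up to sign and scaling, the coefficients of y_0 in the equations, and in [right_end] those of u.
    The same vectors reappear in the boundary rows through f_0 Delta y_0 and y_N, which makes the
    bordered matrix of [bcA] Hermitian. *)
Definition left_end : 'cV[C]_N :=
  \col_i (if i == 0 :> nat then wscale 1 * f 0 else 0)%:C.
Definition right_end : 'cV[C]_N :=
  \col_i (if i == n :> nat then wscale N else 0)%:C.

Lemma jacobi_herm : jacobi^t* = jacobi.
Proof.
apply/matrixP=> i j; rewrite !mxE conjC_rC; congr (_%:C).
rewrite [wscale j.+1 * _]mulrC; congr (_ * _); rewrite /jacobi_entry.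
rewrite [(i.+1 == N) && _]andbC /stencil; congr (_ - _) => /=.
rewrite !eqSS; case: (ltngtP i j) => [ij|ij|ij].
- have [-> ->] : (i == j.+1 :> nat) = false /\ (j.+1 == i :> nat) = false by split; apply/eqP; lia.
  rewrite [j == i.+1 :> nat]eq_sym.
  by case: eqP => [->|]; rewrite ?addr0 ?add0r.
- have [-> ->] : (j == i.+1 :> nat) = false /\ (i.+1 == j :> nat) = false by split; apply/eqP; lia.
  rewrite [i == j.+1 :> nat]eq_sym.
  by case: eqP => [->|]; rewrite ?addr0 ?add0r.
- by rewrite ij.
Qed.

Lemma left_end_neq0 : left_end != 0.
Proof.
apply/eqP => /colP/(_ 0); rewrite !mxE /= => /eqP.
by apply/negP/rC_neq0; rewrite mulf_neq0 ?Hf ?wscale_neq0.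
Qed.

Lemma right_end_neq0 : right_end != 0.
Proof.
apply/eqP => /colP/(_ ord_max); rewrite !mxE /= eqxx => /eqP.
by apply/negP/rC_neq0; rewrite wscale_neq0 //= leqnn.
Qed.

(** The two vectors live on the last and the first coordinate, which differ because N >= 2. *)
Lemma ends_indep (a : C) : right_end != a *: left_end.
Proof.
apply/eqP => /colP/(_ ord_max); rewrite !mxE /= eqxx [n == 0%N]gtn_eqF // mulr0 => /eqP.
by apply/negP/rC_neq0; rewrite wscale_neq0 //= leqnn.
Qed.

Lemma ends_indep' (a : C) : left_end != a *: right_end.
Proof.
apply/eqP => /colP/(_ 0); rewrite !mxE /= [0%N == n]ltn_eqF // mulr0 => /eqP.
by apply/negP/rC_neq0; rewrite mulf_neq0 ?Hf ?wscale_neq0.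
Qed.

Lemma dsl_reduced_entry BC x (i j : 'I_(N.+2)) :
  (rowmx *m (\matrix_(i < N.+2, j < N.+2) dsl_entry BC x i j) *m colmx) i j =
  rowscale i * (dsl_entry BC x (rowidx i) (colidx j) * colscale j +
                dsl_entry BC x (rowidx i) N.+1 * colshift j).
Proof.
rewrite mul_colmx !mul_rowmx ![(\matrix_(_, _) _) _ _]mxE.
by rewrite !inordK ?rowidx_lt ?colidx_lt //= mulrDr !mulrA.
Qed.

Lemma dsl_reduced (BC : 'M[C]_(2, 4)) (x : C)
    (b := fun k c : nat => BC (inord k) (inord c)) :
  rowmx *m (\matrix_(i < N.+2, j < N.+2) dsl_entry BC x i j) *m colmx =
  border2 (b 0 0 - b 0 1 * (f 0)%:C) (b 0 3)
    (b 0 1 *: left_end^t* + b 0 2 *: right_end^t*)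
    (b 1 0 - b 1 1 * (f 0)%:C) (b 1 3)
    (b 1 1 *: left_end^t* + b 1 2 *: right_end^t*)
    (- left_end) (- right_end) (jacobi - x%:M) :> 'M_(N.+2).
Proof.
have fN0 : (f N)%:C != 0 by apply: rC_neq0; exact: Hf.
have N10 : (N.+1 == 0)%N = false by [].
have N11 : (N.+1 == 1)%N = false by [].
have N1N : (N.+1 == N)%N = false by rewrite gtn_eqF.
have NkN k : (N + k < N)%N = false by rewrite ltnNge leq_addr.
have bc_y0 k : (k < 2)%N -> dsl_entry BC x (N + k) 0 = b k 0 - b k 1 * (f 0)%:C.
  move=> k2; rewrite /dsl_entry ltnNge leq_addr addKn /= !addr0; reflexivity.
have bc_u k : (k < 2)%N -> dsl_entry BC x (N + k) N.+1 * (f N)^-1%:C = b k 3.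
  move=> k2; rewrite /dsl_entry NkN; cbv zeta; rewrite addKn eqxx N10 N11 N1N !add0r.
  by rewrite fmorphV mulfK.
(* After the shift the f_N terms of columns N and N + 1 cancel, leaving the coefficient of y_N
   alone. *)
have bc_y k (m : 'I_N) : (k < 2)%N ->
    dsl_entry BC x (N + k) m.+1 * (wscale m.+1)%:C +
    dsl_entry BC x (N + k) N.+1 * (if m.+2 == N.+1 then (wscale N)%:C else 0) =
    (b k 1 *: left_end^t* + b k 2 *: right_end^t*) 0 m.
  move=> k2; rewrite /dsl_entry NkN; cbv zeta; rewrite addKn eqxx N10 N11 N1N !add0r.
  have mN : (m.+1 == N.+1)%N = false by rewrite eqSS ltn_eqF.
  have mn' : (m.+1 == N)%N = (val m == n) by [].
  have mn2 : (m.+2 == N.+1)%N = (val m == n) by [].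
  have m0' : (m.+1 == 1)%N = (val m == 0%N) by [].
  rewrite mN mn' mn2 m0' !mxE !conjC_rC addr0.
  rewrite -/(b k 1) -/(b k 2) -/(b k 3) !rCE.
  case: (val m =P 0%N) => [m0|m0]; case: (val m =P n) => [mn|mn].
  - by move: n1; rewrite -mn m0.
  - rewrite m0 !(mulr0, addr0, add0r) rmorphM /=; ring.
  - rewrite mn !(mulr0, addr0, add0r); ring.
  - by rewrite !(mulr0, mul0r, addr0, add0r).
apply/(@matrixP _ (1 + (1 + N)) (1 + (1 + N))) => i j.
apply: etrans (dsl_reduced_entry BC x i j) _.
have blockE := (block_mxEul, block_mxEur, block_mxEdl, block_mxEdr,
                col_mxEu, col_mxEd, row_mxEl, row_mxEr).
have eq_y0 (k : 'I_N) : dsl_entry BC x k 0 = - (if k == 0 :> nat then f 0 else 0)%:C.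
  rewrite /dsl_entry ltn_ord /stencil.
  have -> : (0 == k.+2)%N = false by [].
  have -> : (0 == k.+1)%N = false by [].
  rewrite mul0r subr0 !add0r [(0 == _)%N]eq_sym /=.
  by case: eqP => [->|_]; rewrite -rmorphN ?oppr0.
have eq_last (k : 'I_N) : dsl_entry BC x k N.+1 = - (if k == n :> nat then f N else 0)%:C.
  rewrite /dsl_entry ltn_ord /stencil.
  have -> : (N.+1 == k.+1)%N = false by rewrite eqSS gtn_eqF.
  have -> : (N.+1 == k.+1.-1)%N = false by rewrite gtn_eqF // (ltn_trans (ltn_ord k)).
  have -> : (N.+1 == k.+2)%N = (val k == n) by rewrite !eqSS eq_sym.
  rewrite mul0r subr0 !addr0 -rmorphN.
  by case: eqP => [->|_] //; rewrite oppr0.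
have eq_y (k m : 'I_N) : (wscale k.+1)%:C *
    (dsl_entry BC x k m.+1 * (wscale m.+1)%:C +
     dsl_entry BC x k N.+1 * (if m.+2 == N.+1 then (wscale N)%:C else 0)) =
    (jacobi - x%:M) k m.
  have -> : (m.+2 == N.+1)%N = (val m == n) by [].
  rewrite eq_last !mxE /jacobi_entry.
  have -> : (m.+1 == N)%N = (val m == n) by [].
  have -> : (k.+1 == N)%N = (val k == n) by [].
  rewrite /dsl_entry ltn_ord.
  rewrite !rCE !rmorphM rmorphB /=.
  have [km|km] := eqVneq k m.
    rewrite km eqxx mulr1n.
    (* The diagonal 1 of the scalar matrix is rewritten as the squared scale times w to match the
       coefficient of lambda. *)
    have /(congr1 (fun a : R => a%:C)) := wscale_sqr (k := m.+1) (ltn_ord m).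
    rewrite !rmorphM /= => ws.
    rewrite -[X in _ = _ - X]mul1r -[1 in RHS]ws.
    case: (val m =P n) => [->|_] /=; rewrite -/N; ring.
  have -> : (m.+1 == k.+1)%N = false by rewrite eqSS eq_sym; apply/negbTE.
  rewrite mulr0n.
  have [mn|mn] := eqVneq (val m) n; last by rewrite /=; ring.
  have [kn|kn] := eqVneq (val k) n.
    by case/eqP: km; apply: val_inj; rewrite /= kn mn.
  by rewrite /=; ring.
have ord3P (k : 'I_(1 + (1 + N))) : [\/ k = lshift (1 + N) 0 :> 'I_(1 + (1 + N)),
    k = rshift 1 (lshift N 0) :> 'I_(1 + (1 + N)) |
    exists k' : 'I_N, k = rshift 1 (rshift 1 k') :> 'I_(1 + (1 + N))].
  case: (@split_ordP 1 (1 + N) k) => k' ->; first by rewrite (ord1 k'); constructor 1.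
  case: (@split_ordP 1 N k') => k'' ->; first by rewrite (ord1 k''); constructor 2.
  by constructor 3; exists k''.
(* Nine blocks: the rows are the two boundary conditions and the equations, the columns y_0, u and
   the scaled y_k. *)
rewrite /border2 /border; case: (ord3P i) => [->|->|[i' ->]];
  case: (ord3P j) => [->|->|[j' ->]]; rewrite !blockE.
- transitivity (1 * (dsl_entry BC x (N + 0) 0 * 1 +
      dsl_entry BC x (N + 0) N.+1 * 0) : C); first by [].
  by rewrite mul1r mulr1 mulr0 addr0 bc_y0 // mxE eqxx mulr1n.
- transitivity (1 * (dsl_entry BC x (N + 0) N.+1 * (f N)^-1%:C +
      dsl_entry BC x (N + 0) N.+1 * 0) : C); first by [].
  by rewrite mul1r mulr0 addr0 bc_u // mxE eqxx mulr1n.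
- transitivity (1 * (dsl_entry BC x (N + 0) j'.+1 * (wscale j'.+1)%:C +
      dsl_entry BC x (N + 0) N.+1 * (if j'.+2 == N.+1 then (wscale N)%:C else 0)) : C);
    first by [].
  by rewrite mul1r bc_y.
- transitivity (1 * (dsl_entry BC x (N + 1) 0 * 1 +
      dsl_entry BC x (N + 1) N.+1 * 0) : C); first by [].
  by rewrite mul1r mulr1 mulr0 addr0 bc_y0 // mxE eqxx mulr1n.
- transitivity (1 * (dsl_entry BC x (N + 1) N.+1 * (f N)^-1%:C +
      dsl_entry BC x (N + 1) N.+1 * 0) : C); first by [].
  by rewrite mul1r mulr0 addr0 bc_u // mxE eqxx mulr1n.
- transitivity (1 * (dsl_entry BC x (N + 1) j'.+1 * (wscale j'.+1)%:C +
      dsl_entry BC x (N + 1) N.+1 * (if j'.+2 == N.+1 then (wscale N)%:C else 0)) : C);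
    first by [].
  by rewrite mul1r bc_y.
- transitivity ((wscale i'.+1)%:C * (dsl_entry BC x i' 0 * 1 +
      dsl_entry BC x i' N.+1 * 0) : C); first by rewrite /rowidx subn2.
  rewrite mulr1 mulr0 addr0 eq_y0 !mxE mulrN -rmorphM.
  by case: (val i' =P 0%N) => [->|_]; rewrite ?mulr0.
- transitivity ((wscale i'.+1)%:C * (dsl_entry BC x i' N.+1 * (f N)^-1%:C +
      dsl_entry BC x i' N.+1 * 0) : C); first by rewrite /rowidx subn2.
  rewrite mulr0 addr0 eq_last !mxE.
  case: (val i' =P n) => [->|_]; last by rewrite oppr0 mul0r mulr0.
  rewrite -/N mulNr mulrN; congr (- _).
  have -> : (f N)%:C * (f N)^-1%:C = 1 by rewrite fmorphV mulfV.
  by rewrite mulr1.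
- transitivity ((wscale i'.+1)%:C * (dsl_entry BC x i' j'.+1 * (wscale j'.+1)%:C +
      dsl_entry BC x i' N.+1 * (if j'.+2 == N.+1 then (wscale N)%:C else 0)) : C);
    first by rewrite /rowidx subn2.
  exact: eq_y.
Qed.

(** The row and column operations depend neither on [BC] nor on x, so one nonzero constant serves
    all problems. *)
Lemma dsl_char_border : exists2 k : C, k != 0 & forall (BC : 'M[C]_(2, 4)) x,
  (dsl_char N f q w BC).[x] = k * \det (border2
    (BC (inord 0) (inord 0) - BC (inord 0) (inord 1) * (f 0)%:C)
    (BC (inord 0) (inord 3))
    (BC (inord 0) (inord 1) *: left_end^t* + BC (inord 0) (inord 2) *: right_end^t*)
    (BC (inord 1) (inord 0) - BC (inord 1) (inord 1) * (f 0)%:C)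
    (BC (inord 1) (inord 3))
    (BC (inord 1) (inord 1) *: left_end^t* + BC (inord 1) (inord 2) *: right_end^t*)
    (- left_end) (- right_end) (jacobi - x%:M)).
Proof.
exists (\det rowmx * \det colmx)^-1.
  by rewrite invr_eq0 mulf_neq0 ?det_rowmx ?det_colmx.
move=> BC x; rewrite dsl_char_horner.
apply: (canRL (mulKf _)); first by rewrite mulf_neq0 ?det_rowmx ?det_colmx.
rewrite mulrAC -!det_mulmx.
by rewrite dsl_reduced.
Qed.

Lemma dsl_char_A : exists2 k : C, k != 0 & forall z a b x,
  (dsl_char N f q w (bcA z a b)).[x] =
  k * charA jacobi left_end right_end z (a + f 0) b x.
Proof.
have [k k0 kE] := dsl_char_border; exists k => // z a b x.
rewrite kE /charA /bcA /mx24 !mxE !inordK //=.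
by rewrite !mulN1r !mul0r opprK subr0 !scaleN1r !scale0r addr0 add0r rmorphD.
Qed.

Lemma dsl_char_S5 : exists2 k : C, k != 0 & forall b x,
  (dsl_char N f q w (bcS5 b)).[x] = k * charS jacobi right_end b x.
Proof.
have [k k0 kE] := dsl_char_border; exists k => // b x.
rewrite kE /charS /bcS5 /mx24 !mxE !inordK //=.
rewrite !mul0r !subr0 !scaleN1r !scale0r !addr0 add0r.
(* The first row of [bcS5] reads y_0 = 0: a pivot 1 alone in its row. *)
rewrite det_border2 ?oner_neq0 // !mulr0 !scale0r !subr0 mulmx0 scaler0 subr0 mul1r.
by [].
Qed.

Lemma dsl_char_S6 : exists2 k : C, k != 0 & forall a x,
  (dsl_char N f q w (bcS6 a)).[x] = k * charS jacobi left_end (a + f 0) x.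
Proof.
have [k k0 kE] := dsl_char_border; exists k => // a x.
rewrite kE /charS /bcS6 /mx24 !mxE !inordK //=.
(* The second row of [bcS6] reads u = 0; exchanging the borders brings its pivot 1 to the front. *)
rewrite !mulN1r !mul0r !subr0 opprK !scaleN1r !scale0r !addr0 det_border2_swap.
rewrite det_border2 ?oner_neq0 // !mulr0 !scale0r !subr0 mulmx0 scaler0 subr0 mul1r.
by rewrite rmorphD.
Qed.

End Reduction.

(** * Symmetry between the two ends and assembly of the theorem *)

Lemma charA_swap (R : rcfType) n (T : 'M[complex R]_n.+1) e g z c b x :
  charA T e g z c b x = charA T g e (z^*)%R b c x.
Proof. by rewrite /charA det_border2_swap conjCK. Qed.

Lemma sqabs_conj (R : rcfType) (z : complex R) : sqabs (z^*)%R = sqabs z.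
Proof. by case: z => x y; rewrite /sqabs /= sqrrN. Qed.

Theorem theorem3p4 (R : rcfType) (N : nat) (f q w : nat -> R)
  (z : complex R) (a11 b22 : R)
  (HN : (2 <= N)%N)
  (Hf : forall n, (n <= N)%N -> f n != 0)
  (Hw : forall n, (1 <= n <= N)%N -> 0 < w n)
  (Hz : z != 0) :
  let nz2 := complex.Re z ^+ 2 + complex.Im z ^+ 2 in (* |z|^2 *)
  let eig := dsl_eigenlist N f q w in
  (* numbers of eigenvalues *)
  (exists s, eig (bcA z a11 b22) s /\
     size s = (if b22 * (a11 + f 0%N) == nz2 then N.-1 else N)) /\
  (exists s, eig (bcS5 b22) s /\ size s = (if b22 == 0 then N.-1 else N)) /\
  (exists s, eig (bcS6 a11) s /\
     size s = (if a11 + f 0%N == 0 then N.-1 else N)) /\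
  (* (i) *)
  (b22 = 0 -> forall a1 a2 : R, a1 < a2 ->
     forall s1 s2 s5 : seq R,
     eig (bcA z a1 b22) s1 -> eig (bcA z a2 b22) s2 -> eig (bcS5 b22) s5 ->
     chain1 N s1 s2 s5) /\
  (* (ii) *)
  (b22 != 0 -> forall a1 a2 a3 a4 : R,
     a1 < a2 -> a2 <= nz2 / b22 - f 0%N -> nz2 / b22 - f 0%N < a3 -> a3 < a4 ->
     forall s1 s2 s3 s4 s5 : seq R,
     eig (bcA z a1 b22) s1 -> eig (bcA z a2 b22) s2 ->
     eig (bcA z a3 b22) s3 -> eig (bcA z a4 b22) s4 -> eig (bcS5 b22) s5 ->
     chain2 N s1 s2 s3 s4 s5 /\
     (a2 < nz2 / b22 - f 0%N -> nth 0 s1 N.-1 <= nth 0 s2 N.-1)) /\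
  (* (iii) *)
  (a11 + f 0%N = 0 -> forall b1 b2 : R, b1 < b2 ->
     forall s1 s2 s6 : seq R,
     eig (bcA z a11 b1) s1 -> eig (bcA z a11 b2) s2 -> eig (bcS6 a11) s6 ->
     chain1 N s1 s2 s6) /\
  (* (iv) *)
  (a11 + f 0%N != 0 -> forall b1 b2 b3 b4 : R,
     b1 < b2 -> b2 <= nz2 / (a11 + f 0%N) -> nz2 / (a11 + f 0%N) < b3 ->
     b3 < b4 ->
     forall s1 s2 s3 s4 s6 : seq R,
     eig (bcA z a11 b1) s1 -> eig (bcA z a11 b2) s2 ->
     eig (bcA z a11 b3) s3 -> eig (bcA z a11 b4) s4 -> eig (bcS6 a11) s6 ->
     chain2 N s1 s2 s3 s4 s6 /\
     (b2 < nz2 / (a11 + f 0%N) -> nth 0 s1 N.-1 <= nth 0 s2 N.-1)).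
Proof.
case: N HN Hf Hw => // n n0 Hf Hw nz2 eig.
pose T := jacobi n f q w; pose e := left_end n f w; pose g := right_end n w.
have hT : T^t* = T by exact: jacobi_herm.
have e0 : e != 0 by exact: left_end_neq0.
have g0 : g != 0 by exact: right_end_neq0.
have ind1 a : g != a *: e by exact: ends_indep.
have ind2 a : e != a *: g by exact: ends_indep'.
have zc0 : (z^*)%R != 0 by rewrite conjC_eq0.
have specA a b s : is_spec (charA T e g z (a + f 0%N) b) s ->
    is_spec (horner (dsl_char n.+1 f q w (bcA z a b))) s.
  have [k k0 kE] := dsl_char_A q n0 Hf Hw; exact: is_spec_scale (kE z a b).
(* The same problem with the borders exchanged and z conjugated: a11 + f_0 becomes the moving
   parameter, so the lemmas on chains in b22 also give those in a11. *)
have specA' a b s : is_spec (charA T g e (z^*)%R b (a + f 0%N)) s ->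
    is_spec (horner (dsl_char n.+1 f q w (bcA z a b))) s.
  have [k k0 kE] := dsl_char_A q n0 Hf Hw; apply: is_spec_scale k0 _ => x.
  by rewrite -charA_swap kE.
have specS5 b s : is_spec (charS T g b) s ->
    is_spec (horner (dsl_char n.+1 f q w (bcS5 b))) s.
  have [k k0 kE] := dsl_char_S5 q n0 Hf Hw; exact: is_spec_scale (kE b).
have specS6 a s : is_spec (charS T e (a + f 0%N)) s ->
    is_spec (horner (dsl_char n.+1 f q w (bcS6 a))) s.
  have [k k0 kE] := dsl_char_S6 q n0 Hf Hw; exact: is_spec_scale (kE a).
split.
  have [s /specA Ss sz] := charA_size hT Hz ind1 (a11 + f 0%N) b22.
  by exists s; split=> //; apply: is_spec_eigenlist.
split.
  have [s /specS5 Ss sz] := charS_size hT g0 b22.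
  by exists s; split=> //; apply: is_spec_eigenlist.
split.
  have [s /specS6 Ss sz] := charS_size hT e0 (a11 + f 0%N).
  by exists s; split=> //; apply: is_spec_eigenlist.
split.
  move=> b0 a1 a2 lt12 s1 s2 s5; rewrite b0.
  have lt12' : a1 + f 0%N < a2 + f 0%N by rewrite ltrD2r.
  have [t1 [t2 [t [[/specA' S1 /specA' S2 /specS5 S]] ch]]] :=
    charA_chain1 e hT zc0 g0 lt12'.
  by move=> /(eigenlist_unique S1)-> /(eigenlist_unique S2)->
            /(eigenlist_unique S)->.
split.
  move=> b0 a1 a2 a3 a4 lt12 le2 lt3 lt34 s1 s2 s3 s4 s5.
  have lt12' : a1 + f 0%N < a2 + f 0%N by rewrite ltrD2r.
  have lt34' : a3 + f 0%N < a4 + f 0%N by rewrite ltrD2r.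
  (* A threshold |z|^2 / b22 for a11 + f_0 is |z|^2 / b22 - f_0 for a11, and conjugation preserves
     |z|. *)
  have le2' : a2 + f 0%N <= sqabs (z^*)%R / b22 by rewrite sqabs_conj -lerBrDr.
  have lt3' : sqabs (z^*)%R / b22 < a3 + f 0%N by rewrite sqabs_conj -ltrBlDr.
  have [t1 [t2 [t3 [t4 [t [[/specA' S1 /specA' S2 /specA' S3 /specA' S4]
      [/specS5 S [ch last]]]]]]]] :=
    charA_chain2 hT ind2 b0 lt12' le2' lt3' lt34'.
  move=> /(eigenlist_unique S1)-> /(eigenlist_unique S2)->
         /(eigenlist_unique S3)-> /(eigenlist_unique S4)->
         /(eigenlist_unique S)->.
  by split=> // lt2; apply: last; rewrite sqabs_conj -ltrBrDr.
split.
  move=> c0 b1 b2 lt12 s1 s2 s6.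
  have [t1 [t2 [t [[S1 S2 S]] ch]]] := charA_chain1 g hT Hz e0 lt12.
  (* The chain was obtained for the corner 0, which is turned back into a11 + f_0. *)
  rewrite -c0 in S1 S2 S.
  by move=> /(eigenlist_unique (specA _ _ _ S1))->
            /(eigenlist_unique (specA _ _ _ S2))->
            /(eigenlist_unique (specS6 _ _ S))->.
move=> c0 b1 b2 b3 b4 lt12 le2 lt3 lt34 s1 s2 s3 s4 s6.
have [t1 [t2 [t3 [t4 [t [[/specA S1 /specA S2 /specA S3 /specA S4]
    [/specS6 S [ch last]]]]]]]] :=
  charA_chain2 hT ind1 c0 lt12 le2 lt3 lt34.
by move=> /(eigenlist_unique S1)-> /(eigenlist_unique S2)->
          /(eigenlist_unique S3)-> /(eigenlist_unique S4)->
          /(eigenlist_unique S)->.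
Qed.
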